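(* For every $\varepsilon>0$, there exists a $3$-graph $F$ with $\pi_{\mathrm{u}}(F)\geq 4/27$ and $\pi_{\mathrm{co}}(F)\leq\varepsilon$.
   Context: A $3$-graph is a $3$-uniform hypergraph. For a $3$-graph $H$ and a set $S$ of vertices, $d_H(S)$ is the number of edges containing $S$; the minimum codegree $\delta_{\mathrm{co}}(H)$ is the minimum of $d_H(S)$ over all $2$-subsets $S\subseteq V(H)$. For a $3$-graph $F$, $\mathrm{ex}_{\mathrm{co}}(n,F)$ is the maximum of $\delta_{\mathrm{co}}(H)$ over all $n$-vertex $F$-free $3$-graphs $H$, and the codegree Turán density is $\pi_{\mathrm{co}}(F)=\lim_{n\to\infty}\mathrm{ex}_{\mathrm{co}}(n,F)/n$ (this limit exists). For $d\in[0,1]$ and $\eta>0$, an $n$-vertex $3$-graph $H$ is uniformly $(d,\eta)$-dense if for all $U\subseteq V(H)$, $|\binom{U}{3}\cap E(H)|\geq d\binom{|U|}{3}-\eta n^3$. The uniform Turán density $\pi_{\mathrm{u}}(F)$ is the supremum of all $d\in[0,1]$ such that for every $\eta>0$ and $n_0\in\mathbb{N}$ there exists an $F$-free uniformly $(d,\eta)$-dense $3$-graph $H$ with $|V(H)|\geq n_0$. *)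

(* Defs.v *)
From HB Require Import structures.
From mathcomp Require Export all_boot all_order all_algebra.
From mathcomp Require Export all_classical all_reals all_analysis.

Set Implicit Arguments.
Unset Strict Implicit.
Unset Printing Implicit Defensive.

Import Order.TTheory GRing.Theory Num.Theory.
Import numFieldNormedType.Exports.

Local Open Scope ring_scope.
Local Open Scope classical_set_scope.

Record tgraph (V : finType) := TGraph {
  edges : {set {set V}};
  edges_card3 : [forall e in edges, #|e| == 3%N]
}.

HB.instance Definition _ (V : finType) := [isSub for @edges V].
HB.instance Definition _ (V : finType) := [Finite of tgraph V by <:].

Definition degree (V : finType) (H : tgraph V) (S : {set V}) : nat :=
  #|[set e in edges H | S \subset e]|.

(* When #|V| >= 2 the default value #|V| of the minimum is irrelevant, since
   every pair has codegree at most #|V| - 2. *)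
Definition min_codegree (V : finType) (H : tgraph V) : nat :=
  \big[minn/#|V|]_(S : {set V} | #|S| == 2%N) degree H S.

(* Not necessarily induced copies. *)
Definition contains_copy (W V : finType) (F : tgraph W) (H : tgraph V) : bool :=
  [exists f : {ffun W -> V},
    injectiveb f && [forall e in edges F, (f @: (e : {set W}))%SET \in edges H]].

Definition is_free (W V : finType) (F : tgraph W) (H : tgraph V) : bool :=
  ~~ contains_copy F H.

(* The value is 0 if there is no F-free 3-graph on n vertices, which happens
   only when F has no edges. *)
Definition ex_co (W : finType) (n : nat) (F : tgraph W) : nat :=
  (\max_(H : tgraph 'I_n | is_free F H) min_codegree H)%N.

Definition codegree_turan_density (R : realType) (W : finType) (F : tgraph W)
    : R :=
  lim ((fun n : nat => (ex_co n F)%:R / n%:R : R) @ \oo).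

Definition uniformly_dense (R : realType) (V : finType) (d eta : R)
    (H : tgraph V) : Prop :=
  forall U : {set V},
    d * ('C(#|U|, 3))%:R - eta * #|V|%:R ^+ 3
      <= #|[set e in edges H | e \subset U]|%:R.

Definition uniform_turan_density (R : realType) (W : finType) (F : tgraph W)
    : R :=
  sup [set d : R | 0 <= d <= 1 /\
    forall (eta : R) (n0 : nat), 0 < eta ->
      exists (V : finType) (H : tgraph V),
        [/\ (n0 <= #|V|)%N, is_free F H & uniformly_dense d eta H]].

(* Main.v *)
Require Import Defs.
From mathcomp Require Import fintype finset zify ring lra.

Import Order.TTheory GRing.Theory Num.Theory.
Import numFieldNormedType.Exports.

Set Implicit Arguments.
Unset Strict Implicit.
Unset Printing Implicit Defensive.

(** Call a 3-graph [extendable] if for distinct [p], [q], [v] some [u != v] forms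
an edge with [p] and [q].  In a large 3-graph of minimum codegree at least
[n / k], a random [M]-subset is extendable with probability close to 1 once
[M] is large, so some extendable 3-graph [O] on [M] vertices occurs with positive
density, and then so do all its blow-ups.  The product [F] of all extendable
3-graphs on [M] vertices maps homomorphically to each such [O]; hence it is
contained in a blow-up of [O], and the codegree Turan density of [F] is at most
[1 / k].

For the uniform density, order the vertices, colour the pairs red and blue with
frequencies 2/3 and 1/3 in a quasirandom way, and let [x < y < z] form an edge
if [xy] and [xz] are red and [yz] is blue.  This has density 4/27 on all large
sets.  It does not contain [F] because every pair of a factor has two
neighbours.  The colouring is explicit:
a pair is blue if its two vectors over the field with three elements are
orthogonal, and the order is provided by a partition into blocks. *)

(** * Boxes in dense sets of tuples *)

Lemma pigeonhole_fiber (T I : finType) (A : {set T}) (D : {set I}) (f : T -> I) :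
  0 < #|D| -> (forall x, x \in A -> f x \in D) ->
  exists2 i, i \in D & #|A| <= #|D| * #|[set x in A | f x == i]|.
Proof.
case/card_gt0P=> i0 i0D fD.
pose c i := #|[set x in A | f x == i]|.
have [i iD imax] := @arg_maxnP _ i0 (mem D) c i0D.
exists i => //; rewrite -/(c i) -sum1_card (partition_big f (mem D)) //=.
rewrite -sum_nat_const; apply: leq_sum => j jD.
apply: leq_trans (imax j jD); rewrite /c -sum1_card.
by rewrite [leqRHS](eq_bigl (fun x => (x \in A) && (f x == j))) // => x; rewrite !inE.
Qed.

Lemma card_tuple_fibers (V : finType) k (E : {set k.+1.-tuple V}) :
  #|E| = \sum_(b : V) #|[set y : k.-tuple V | [tuple of b :: y] \in E]|.
Proof.
rewrite -sum1_card big_mkcond /=.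
rewrite (reindex (fun p : V * k.-tuple V => [tuple of p.1 :: p.2])) /=; last first.
  exists (fun x : k.+1.-tuple V => (thead x, [tuple of behead x])) => [[b y] _|x _].
    by congr pair; apply: val_inj.
  by rewrite /= [in RHS](tuple_eta x).
rewrite -(pair_big xpredT xpredT
  (fun b (y : k.-tuple V) => if [tuple of b :: y] \in E then 1 else 0)) /=.
apply: eq_bigr => b _; rewrite -sum1_card -big_mkcond /=.
by apply: eq_bigl => y; rewrite inE.
Qed.

(* Erdős's theorem on complete k-partite k-graphs. *)
Lemma dense_tuples_contain_box k t K : exists n0, forall V : finType,
  n0 <= #|V| -> forall E : {set k.-tuple V}, #|V| ^ k <= K * #|E| ->
  exists A : nat -> {set V}, (forall i, i < k -> t <= #|A i|) /\
    forall x : k.-tuple V, (forall i : 'I_k, tnth x i \in A i) -> x \in E.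
Proof.
elim: k K => [|k IH] K.
  exists 0 => V _ E; rewrite expn0 muln_gt0 => /andP[_ /card_gt0P[y yE]].
  by exists (fun=> set0); split=> // x _; rewrite (tuple0 x) -(tuple0 y).
(* Among [s] fibres of density at least [1 / (2 * K)], an average [y] lies in at least [2 * t.+1],
   so a proportion [1 / (4 * K)] of all [y] lies in more than [t] of them. *)
pose s := 4 * K * t.+1.
have [n0 Hn0] := IH (4 * K * 2 ^ s).
exists (maxn 1 (maxn n0 (2 * K * s))) => V; rewrite !geq_max => /and3P[V1 Vn0 Vs] E EK.
set n := #|V| in V1 Vs EK.
have nk0 : 0 < n ^ k by rewrite expn_gt0 V1.
have K0 : 0 < K by case: K EK {s Hn0 Vs} => // ; rewrite mul0n leqn0 expn_eq0; lia.
pose fib b := [set y : k.-tuple V | [tuple of b :: y] \in E].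
pose good := [set b | n ^ k <= 2 * K * #|fib b|].
have card_ktuple : #|{: k.-tuple V}| = n ^ k by rewrite card_tuple.
have good_ge : s <= #|good|.
  have : 2 * K * #|E| <= #|good| * (2 * K * n ^ k) + n * n ^ k.
    rewrite card_tuple_fibers big_distrr /= (bigID (mem good)) /=.
    apply: leq_add.
      rewrite -sum_nat_const; apply: leq_sum => b _.
      by rewrite leq_mul2l -card_ktuple max_card orbT.
    apply: (@leq_trans (\sum_(b : V) n ^ k)); last by rewrite sum_nat_const.
    rewrite big_mkcond /=; apply: leq_sum => b _.
    by rewrite inE -ltnNge; case: ltnP => // /ltnW.
  move: EK; rewrite expnS => EK H.
  have : n <= #|good| * (2 * K).
    by rewrite -(leq_pmul2r nk0); lia.
  move=> H2; have : 2 * K * s <= 2 * K * #|good| by lia.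
  by rewrite leq_pmul2l //; lia.
have [B /= sBg cB] : exists2 B : {set V}, B \subset good & #|B| = s.
  exists [set x in take s (enum good)].
    by apply/subsetP=> x; rewrite inE => /mem_take; rewrite mem_enum.
  rewrite cardsE; have /card_uniqP -> : uniq (take s (enum good)).
    by rewrite take_uniq ?enum_uniq.
  by rewrite size_takel // -cardE.
pose S y := [set b in B | y \in fib b].
have S_sum : \sum_y #|S y| = \sum_(b in B) #|fib b|.
  transitivity (\sum_y \sum_(b in B) (y \in fib b : nat)).
    apply: eq_bigr => y _; rewrite -sum1_card -big_mkcondr /=.
    by apply: eq_bigl => b; rewrite inE.
  rewrite exchange_big /=; apply: eq_bigr => b _.
  by rewrite -sum1_card [in RHS]big_mkcond; apply: eq_bigr => y _; case: (_ \in _).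
pose rich := [set y | t < #|S y|].
have rich_ge : n ^ k <= 4 * K * #|rich|.
  have H1 : s * n ^ k <= 2 * K * \sum_y #|S y|.
    rewrite S_sum big_distrr /= -cB -sum_nat_const; apply: leq_sum => b bB.
    by have := subsetP sBg b bB; rewrite inE.
  have H2 : \sum_y #|S y| <= #|rich| * s + t * n ^ k.
    rewrite (bigID (mem rich)) /=; apply: leq_add.
      rewrite -sum_nat_const; apply: leq_sum => y _; rewrite -cB.
      by apply: subset_leq_card; apply/subsetP=> b; rewrite inE => /andP[].
    rewrite mulnC -card_ktuple -sum_nat_const big_mkcond /=; apply: leq_sum => y _.
    by rewrite inE /= -leqNgt; case: ifP.
  have H3 : 2 * K * (2 * t.+1 * n ^ k) <= 2 * K * (#|rich| * s + t * n ^ k).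
    by apply: leq_trans (leq_trans H1 _); [rewrite /s; lia | rewrite leq_mul2l H2 orbT].
  have H4 : 2 * t.+1 * n ^ k <= #|rich| * s + t * n ^ k.
    by move: H3; rewrite leq_pmul2l //; lia.
  have : t.+1 * n ^ k <= t.+1 * (4 * K * #|rich|) by rewrite /s in H4; nia.
  by rewrite leq_pmul2l.
(* The set of fibres through [y] takes at most [2 ^ s] values; the most popular one on [rich], [S0],
   becomes the first side of the box. *)
have [||S0 _ S0_ge] := @pigeonhole_fiber _ _ rich (powerset B) S.
- by rewrite card_powerset expn_gt0.
- by move=> y _; rewrite powersetE; apply/subsetP=> b; rewrite inE => /andP[].
rewrite card_powerset cB in S0_ge.
pose E' := [set y in rich | S y == S0].
have E'_ge : n ^ k <= 4 * K * 2 ^ s * #|E'|.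
  by apply: leq_trans rich_ge _; rewrite -[leqRHS]mulnA leq_mul2l S0_ge orbT.
have [A [At AE]] := Hn0 V Vn0 E' E'_ge.
have [y0 y0E] : exists y, y \in E'.
  by apply/card_gt0P; case: #|E'| E'_ge; rewrite ?muln0 //; lia.
exists (fun i => if i is j.+1 then A j else S0); split.
  case=> [_|i ik]; last exact: At.
  by move: y0E; rewrite !inE => /andP[r /eqP <-]; apply: ltnW.
move=> x xA; rewrite (tuple_eta x).
have : [tuple of behead x] \in E'.
  apply: AE => i; have := xA (lift ord0 i).
  by rewrite (_ : tnth x _ = tnth [tuple of behead x] i) // tnth_behead;
    congr tnth; apply: val_inj => /=; rewrite /bump leq0n inordK //= ltnS.
rewrite !inE => /andP[_ /eqP SE]; have := xA ord0.
by rewrite -SE !inE => /andP[_].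
Qed.

(** * Random samples of 3-graphs of large codegree *)

(** Makes the union bound over triples of sampled vertices small. Bernoulli's inequality gives
    [(1 + 1 / q) ^ k >= k / q], and the fourth power of this outgrows a cubic. *)
Lemma exp_beats_cubic p :
  exists2 m, 0 < m & 4 * m.+3 ^ 3 * p ^ m <= p.+1 ^ m.
Proof.
case: p => [|p]; first by exists 1.
pose q := p.+1; rewrite -/q.
have bern k : q ^ k * (q + k) <= q * q.+1 ^ k.
  elim: k => [|k IH]; first by rewrite !expn0; lia.
  rewrite !expnS; nia.
(* Since [1372 = 4 * 7 ^ 3], this choice gives [k ^ 4 = q ^ 4 * (4 * (7 * k) ^ 3)]. The existential
   keeps [k] opaque. *)
have [k Dk] : exists k, k = 1372 * q ^ 4 by exists (1372 * q ^ 4).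
have q40 : 0 < q ^ 4 by rewrite expn_gt0.
have k0 : 0 < k by rewrite Dk; lia.
exists (4 * k); first by lia.
have H : q ^ (4 * k) * k ^ 4 <= q ^ 4 * q.+1 ^ (4 * k).
  rewrite ![4 * k]mulnC !expnM -!expnMn leq_exp2r //.
  by apply: leq_trans (bern k); rewrite leq_mul2l leq_addl orbT.
have H2 : q ^ 4 * (4 * (4 * k).+3 ^ 3) <= k ^ 4.
  have H3 : (4 * k).+3 ^ 3 <= (7 * k) ^ 3 by rewrite leq_exp2r //; lia.
  have -> : k ^ 4 = q ^ 4 * (4 * (7 * k) ^ 3).
    by rewrite expnS {1}Dk expnMn; lia.
  by rewrite leq_mul2l leq_mul2l H3 !orbT.
rewrite -(leq_pmul2l q40); apply: leq_trans H.
by rewrite mulnA mulnC leq_mul2l H2 orbT.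
Qed.

Lemma card_le_cover (T X : finType) (A : {set X}) (F : T -> {set X}) B :
  (forall x, x \in A -> exists t, x \in F t) -> (forall t, #|F t| <= B) ->
  #|A| <= #|T| * B.
Proof.
move=> AF FB; rewrite -sum_nat_const.
apply: (@leq_trans (\sum_t #|F t|)); last exact: leq_sum.
rewrite -sum1_card.
apply: (@leq_trans (\sum_(x in A) \sum_t (x \in F t : nat))).
  apply: leq_sum => x /AF [t xt].
  by rewrite (bigD1 t) //= xt.
rewrite exchange_big /=; apply: leq_sum => t _.
rewrite -[leqRHS]sum1_card [leqLHS]big_mkcond [leqRHS]big_mkcond.
by apply: leq_sum => x _; case: (x \in A); case: (x \in F t).
Qed.

Lemma card_family_le (I V : finType) (D : {set I}) (F : I -> pred V) L :
  (forall i, i \in D -> #|F i| <= 1) -> (forall i, i \notin D -> #|F i| <= L) ->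
  #|[set f : {ffun I -> V} | f \in family F]| <= L ^ #|~: D|.
Proof.
move=> FD FL; rewrite cardsE card_family foldrE big_map big_enum /=.
apply: (@leq_trans (\prod_(i : I) (if i \in ~: D then L else 1))).
  apply: leq_prod => i _; rewrite inE.
  by case: ifPn => [/FL|/negPn/FD].
by rewrite -big_mkcond prod_nat_const.
Qed.

Lemma card_set3 (V : finType) (a b c : V) :
  (#|[set a; b; c]| == 3) = [&& a != b, a != c & b != c].
Proof.
rewrite setUC cardsU1 cards2 !inE ![c == _]eq_sym.
by case: (a == b); case: (a == c); case: (b == c).
Qed.

Lemma imset_set3 (V W : finType) (f : V -> W) (a b c : V) :
  [set f x | x in [set a; b; c]] = [set f a; f b; f c].
Proof. by rewrite imsetU imsetU1 !imset_set1. Qed.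

Definition link (V : finType) (H : tgraph V) (a b : V) : {set V} :=
  [set x | [set a; b; x] \in edges H].

Lemma edge_card3 (V : finType) (H : tgraph V) (e : {set V}) :
  e \in edges H -> #|e| = 3.
Proof. by move=> eH; have /forallP/(_ e) := edges_card3 H; rewrite eH => /eqP. Qed.

Lemma edge_neq (V : finType) (H : tgraph V) (a b c : V) :
  [set a; b; c] \in edges H -> [/\ a != b, a != c & b != c].
Proof.
by move/edge_card3/eqP; rewrite card_set3 => /and3P[].
Qed.

Lemma min_codegree_le_link (V : finType) (H : tgraph V) (a b : V) :
  a != b -> min_codegree H <= #|link H a b|.
Proof.
move=> ab; apply: (@leq_trans (degree H [set a; b])).
  rewrite /min_codegree.
  have : #|[set a; b]| == 2 by rewrite cards2 ab.
  move: [set a; b] => S S2.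
  have : S \in index_enum {set V} by rewrite mem_index_enum.
  elim: (index_enum _) => // S' r IH; rewrite inE big_cons => /predU1P[<-|Sr].
    by rewrite S2 geq_minl.
  by case: ifP => _; [rewrite geq_min IH // orbT | exact: IH].
apply: leq_trans (leq_imset_card (fun x => [set a; b; x]) _).
apply/subset_leq_card/subsetP=> e; rewrite inE => /andP[eH sub].
have : #|e :\: [set a; b]| == 1.
  by rewrite cardsD (setIidPr sub) cards2 ab (edge_card3 eH).
case/cards1P=> x ex.
have De : e = [set a; b; x] by rewrite -(setID e [set a; b]) (setIidPr sub) ex.
by apply/imsetP; exists x; rewrite // inE -De.
Qed.

Definition extendable (V : finType) (O : tgraph V) : bool :=
  [forall p, forall q, forall v, [&& p != q, v != p & v != q] ==>
    [exists u, (u != v) && ([set p; q; u] \in edges O)]].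

Lemma extendableP (V : finType) (O : tgraph V) :
  reflect (forall p q v, p != q -> v != p -> v != q ->
             exists2 u, u != v & [set p; q; u] \in edges O)
          (extendable O).
Proof.
apply: (iffP forallP) => [ext p q v pq vp vq | ext p].
  have /forallP/(_ q)/forallP/(_ v) := ext p.
  by rewrite pq vp vq => /existsP[u /andP[]]; exists u.
apply/forallP=> q; apply/forallP=> v; apply/implyP=> /and3P[pq vp vq].
by have [u uv uO] := ext p q v pq vp vq; apply/existsP; exists u; rewrite uv.
Qed.

Section Pullback.
Variables (I V : finType) (f : I -> V) (H : tgraph V).

(** The size condition removes larger sets that [f] collapses onto an edge. *)
Definition pullback_edges : {set {set I}} :=
  [set e : {set I} | (#|e| == 3) && ([set f i | i in e] \in edges H)].

Lemma pullback_subproof : [forall e in pullback_edges, #|e| == 3].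
Proof. by apply/forall_inP=> e; rewrite inE => /andP[]. Qed.

Definition pullback : tgraph I := TGraph pullback_subproof.

End Pullback.

Section Sampling.
Variables (m d : nat) (V : finType) (H : tgraph V).
Hypothesis codeg : forall a b, a != b -> d <= #|link H a b|.
Let M := m.+3.
Let n := #|V|.

(** Union bound over all maps. The first error term fixes three positions that violate extendability
    and their values, after which the other [m] values all avoid a link of size at least [d]. The
    second fixes two positions and the value they share. *)
Lemma card_injective_extendable :
  n ^ M <= #|[set f : {ffun 'I_M -> V} | injectiveb f && extendable (pullback f H)]|
           + M ^ 3 * n ^ 3 * (n - d) ^ m + M ^ 2 * n * n ^ m.+1.
Proof.
set G := finset _.
pose X := [set f : {ffun 'I_M -> V} | ~~ injectiveb f].
pose Y := [set f : {ffun 'I_M -> V} | injectiveb f && ~~ extendable (pullback f H)].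
have -> : n ^ M = #|{ffun 'I_M -> V}| by rewrite card_ffun card_ord.
have XGY : [set: {ffun 'I_M -> V}] \subset G :|: Y :|: X.
  by apply/subsetP=> f _; rewrite !inE;
    case: (injectiveb f); case: (extendable (pullback f H)).
rewrite -cardsT; apply: leq_trans (subset_leq_card XGY) _.
apply: leq_trans (leq_card_setU _ _) _; apply: leq_add; last first.
  pose F (t : 'I_M * 'I_M * V) :=
    if t.1.1 == t.1.2 then set0 else
    [set f : {ffun 'I_M -> V} | f \in family (fun i =>
       [pred x : V | (i \in [set t.1.1; t.1.2]) ==> (x == t.2)])].
  apply: leq_trans (@card_le_cover _ _ _ F (n ^ m.+1) _ _) _.
  - move=> f; rewrite inE => /injectivePn[i [j ij fij]].
    exists (i, j, f i); rewrite /F /= (negPf ij) inE.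
    apply/familyP=> k; rewrite !inE; apply/implyP.
    by case/orP=> /eqP -> //; rewrite fij.
  - case=> [[i j] a]; rewrite /F /=; case: (eqVneq i j) => [|ij]; first by rewrite cards0.
    have -> : m.+1 = #|~: [set i; j]|.
      by rewrite cardsCs setCK card_ord cards2 ij.
    apply: card_family_le => k kD; last exact: max_card.
    apply: leq_trans (_ : #|pred1 a| <= 1); last by rewrite card1.
    by apply: subset_leq_card; apply/subsetP=> x;
      rewrite !inE in kD *; rewrite kD.
  by rewrite !card_prod card_ord -/n /M; lia.
apply: leq_trans (leq_card_setU _ _) _; rewrite leq_add2l.
pose F (t : 'I_M * 'I_M * 'I_M * (V * V * V)) :=
  let: (i, j, k, (a, b, c)) := t in
  if [&& i != j, k != i, k != j & a != b] then
    [set f : {ffun 'I_M -> V} | f \in family (fun l =>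
       if l == i then pred1 a else if l == j then pred1 b else
       if l == k then pred1 c else [pred x | x \in ~: link H a b])]
  else set0.
apply: leq_trans (@card_le_cover _ _ _ F ((n - d) ^ m) _ _) _.
- move=> f; rewrite inE => /andP[/injectiveP finj].
  case/forallPn=> i /forallPn[j /forallPn[k]].
  rewrite negb_imply => /andP[/and3P[ij ki kj] /existsPn nou].
  exists (i, j, k, (f i, f j, f k)); rewrite /F ij ki kj /=.
  have fij : f i != f j by apply: contra_neq ij => /finj.
  rewrite fij inE; apply/familyP=> l.
  case: eqVneq => [->|li]; first by rewrite inE.
  case: eqVneq => [->|lj]; first by rewrite inE.
  case: eqVneq => [->|lk]; first by rewrite inE.
  rewrite !inE; have := nou l; rewrite lk /=; apply: contra => Hl.
  by rewrite inE imset_set3 Hl andbT card_set3 ij eq_sym li eq_sym lj.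
- case=> [[[i j] k] [[a b] c]]; rewrite /F; case: ifP => [|_]; last by rewrite cards0.
  case/and4P=> ij ki kj ab.
  have -> : m = #|~: [set i; j; k]|.
    have /eqP c3 : #|[set i; j; k]| == 3 by rewrite card_set3 ij eq_sym ki eq_sym kj.
    by rewrite cardsCs setCK card_ord c3 /M; lia.
  apply: card_family_le => l; rewrite !inE; last first.
    rewrite !negb_or => /andP[/andP[/negPf -> /negPf ->] /negPf ->].
    have := codeg ab; have := cardsC (link H a b); rewrite -/n.
    rewrite (eq_card (_ : [pred x | x \in ~: link H a b] =i ~: link H a b)) //; lia.
  case/orP=> [/orP[]|] /eqP ->; rewrite ?eqxx ?card1 //.
    by case: ifP; rewrite card1.
  by case: ifP; rewrite ?card1 //; case: ifP; rewrite card1.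
by rewrite !card_prod card_ord -/n /M; lia.
Qed.

End Sampling.

(** * The product of the extendable 3-graphs *)

Section Product.
Variable M : nat.

Definition extendable_graph := {O : tgraph 'I_M | extendable O}.

Definition product_vertex := {ffun extendable_graph -> 'I_M}.

Definition product_edges : {set {set product_vertex}} :=
  [set e : {set product_vertex} | (#|e| == 3) &&
     [forall O : extendable_graph,
        [set w O | w : product_vertex in e] \in edges (val O)]].

Lemma product_subproof : [forall e in product_edges, #|e| == 3].
Proof. by apply/forall_inP=> e; rewrite inE => /andP[]. Qed.

Definition product_graph : tgraph product_vertex := TGraph product_subproof.

End Product.

Lemma complete_subproof (V : finType) :
  [forall e in [set e : {set V} | #|e| == 3], #|e| == 3].
Proof. by apply/forall_inP=> e; rewrite inE. Qed.

Definition complete_graph (V : finType) : tgraph V := TGraph (complete_subproof V).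

Lemma complete_extendable (V : finType) : 3 < #|V| -> extendable (complete_graph V).
Proof.
move=> V4; apply/extendableP=> p q v pq vp vq.
have [u uN] : exists u, u \in ~: [set p; q; v].
  apply/card_gt0P; have := cardsC [set p; q; v].
  have /eqP -> : #|[set p; q; v]| == 3 by rewrite card_set3 pq eq_sym vp eq_sym vq.
  by lia.
move: uN; rewrite !inE !negb_or => /andP[/andP[up uq] uv].
by exists u; rewrite // inE card_set3 pq eq_sym up eq_sym uq.
Qed.

(** The product vertex [w] is sent into the part [A (w O)], so that the projection to the factor [O]
    turns product edges into edges of the blow-up. Disjointness of the parts is encoded in the
    injectivity of every transversal [f]. *)
Lemma blowup_contains_product M (O : extendable_graph M) (V : finType) (H : tgraph V)
    (v0 : V) (A : nat -> {set V}) :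
  (forall i, i < M -> #|product_vertex M| <= #|A i|) ->
  (forall f : {ffun 'I_M -> V}, (forall i, f i \in A i) ->
     injective f /\ pullback f H = val O) ->
  contains_copy (product_graph M) H.
Proof.
move=> At AO.
pose pt i (w : product_vertex M) := nth v0 (enum (A i)) (enum_rank w).
have rk i (w : product_vertex M) : i < M -> enum_rank w < size (enum (A i)).
  by move=> iM; rewrite -cardE; exact: leq_trans (ltn_ord _) (At i iM).
have ptA i w : i < M -> pt i w \in A i.
  by move=> iM; rewrite -mem_enum mem_nth // rk.
(* A transversal may follow a different product vertex in each part. *)
have choose (g : 'I_M -> product_vertex M) :
    injective (fun i : 'I_M => pt i (g i)) /\
    pullback (fun i : 'I_M => pt i (g i)) H = val O.
  have [|inj pb] := AO [ffun i : 'I_M => pt i (g i)].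
    by move=> i; rewrite ffunE ptA.
  split; first by move=> i j ij; apply: inj; rewrite !ffunE.
  rewrite -pb; congr pullback.
  by apply: funext => i; rewrite ffunE.
apply/existsP; exists [ffun w : product_vertex M => pt (w O) w]; apply/andP; split.
  apply/injectiveP=> w w'; rewrite !ffunE => ww'.
  case: (eqVneq (w O) (w' O)) => [wO|wO]; last first.
    have [/(_ (w O) (w' O)) inj _] := choose (fun i => if i == w O then w else w').
    by move: inj; rewrite eqxx [w' O == _]eq_sym (negPf wO) => /(_ ww') /eqP;
      rewrite (negPf wO).
  move: ww'; rewrite wO => /eqP; rewrite nth_uniq ?enum_uniq ?rk //.
  by move/eqP => h; apply: enum_rank_inj; apply: val_inj.
apply/forall_inP=> e; rewrite inE => /andP[/eqP e3 /forallP /(_ O) eO].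
have /imset_injP einj : #|[set w O | w : product_vertex M in e]| == #|e|.
  by rewrite e3 (edge_card3 eO).
have [w1 w1e] : exists w, w \in e by apply/card_gt0P; rewrite e3.
(* An edge [e] has at most one vertex over each part; [g] selects it, with the default [w1] over the
   parts that [e] misses. *)
pose g i := odflt w1 [pick w in e | w O == i].
have gE w : w \in e -> g (w O) = w.
  move=> we; rewrite /g; case: pickP => [w' /andP[w'e /eqP w'O]|/(_ w)].
    exact: einj.
  by rewrite we eqxx.
have [_ pb] := choose g.
move: eO; rewrite -pb inE => /andP[_].
rewrite -imset_comp; set e' := imset _ _; set e'' := imset _ _.
suff -> : e' = e'' by [].
by apply: eq_in_imset => w we /=; rewrite ffunE gE.
Qed.

Lemma codegree_forces_product p : exists2 M, 3 < M &
  exists n0, forall (V : finType) (H : tgraph V), n0 <= #|V| ->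
    #|V| <= p.+1 * min_codegree H -> contains_copy (product_graph M) H.
Proof.
have [m m0 hm] := exp_beats_cubic p.
pose M := m.+3; exists M; first by rewrite /M; lia.
pose D := [set O : tgraph 'I_M | extendable O].
have D0 : 0 < #|D|.
  apply/card_gt0P; exists (complete_graph 'I_M); rewrite inE complete_extendable //.
  by rewrite card_ord /M; lia.
(* Each error term of the sampling bound will be at most a quarter of all maps, so at least half of
   the maps are good, and some pullback [O] among the [#|D|] possible ones accounts for a proportion
   at least [1 / (2 * #|D|)]. *)
have [n1 box] := dense_tuples_contain_box M #|product_vertex M| (2 * #|D|).
exists (maxn 1 (maxn n1 (4 * M ^ 2))) => V H; rewrite !geq_max => /and3P[V1 Vn1 VM] codeg.
set n := #|V| in V1 Vn1 VM codeg.
pose d := min_codegree H.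
have := card_injective_extendable m (fun a b => @min_codegree_le_link V H a b).
rewrite -/n -/d -/M; set G := [set f | _] => Gge.
have G2 : n ^ M <= 2 * #|G|.
  have H1 : 4 * (M ^ 3 * n ^ 3 * (n - d) ^ m) <= n ^ M.
    (* A random vertex misses a given link with probability at most [p / p.+1]; the [m]-th power of
       this absorbs [4 * M ^ 3] by [hm]. *)
    have nd : p.+1 * (n - d) <= p * n by rewrite -/d in codeg; nia.
    have : (p.+1 * (n - d)) ^ m <= (p * n) ^ m by rewrite leq_exp2r.
    rewrite !expnMn => nd'.
    have pm0 : 0 < p.+1 ^ m by rewrite expn_gt0.
    rewrite -(leq_pmul2l pm0).
    have -> : n ^ M = n ^ 3 * n ^ m by rewrite -expnD.
    apply: (@leq_trans (4 * M ^ 3 * n ^ 3 * (p ^ m * n ^ m))).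
      have -> : p.+1 ^ m * (4 * (M ^ 3 * n ^ 3 * (n - d) ^ m)) =
                4 * M ^ 3 * n ^ 3 * (p.+1 ^ m * (n - d) ^ m) by ring.
      by rewrite leq_mul2l nd' orbT.
    have -> : 4 * M ^ 3 * n ^ 3 * (p ^ m * n ^ m) =
              (4 * M ^ 3 * p ^ m) * (n ^ 3 * n ^ m) by ring.
    by rewrite leq_mul2r hm orbT.
  have H2 : 4 * (M ^ 2 * n * n ^ m.+1) <= n ^ M.
    have -> : 4 * (M ^ 2 * n * n ^ m.+1) = (4 * M ^ 2) * n ^ m.+2.
      by rewrite [n ^ m.+2]expnS; ring.
    by rewrite /M [n ^ m.+3]expnS leq_mul2r VM orbT.
  by lia.
have [||O OD GO] := @pigeonhole_fiber _ _ G D (fun f => pullback f H).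
- by [].
- by move=> f; rewrite !inE => /andP[].
pose E := [set [tuple f i | i < M] | f : {ffun 'I_M -> V} in
  [set f in G | pullback f H == O]].
have tinj : injective (fun f : {ffun 'I_M -> V} => [tuple f i | i < M]).
  move=> f g fg; apply/ffunP=> i.
  by have := congr1 (fun t => tnth t i) fg; rewrite !tnth_mktuple.
have [A [At AE]] : exists A : nat -> {set V},
    (forall i, i < M -> #|product_vertex M| <= #|A i|) /\
    forall x : M.-tuple V, (forall i : 'I_M, tnth x i \in A i) -> x \in E.
  apply: box => //; rewrite card_imset //.
  by rewrite -mulnA; apply: leq_trans G2 _; rewrite leq_mul2l GO orbT.
rewrite inE in OD.
have /card_gt0P [v0 _] := V1.
apply: (@blowup_contains_product M (exist _ O OD) V H v0 A At) => f fA.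
have : [tuple f i | i < M] \in E by apply: AE => i; rewrite tnth_mktuple.
case/imsetP=> f' f'G /tinj ->.
by move: f'G; rewrite !inE => /andP[/andP[/injectiveP inj _] /eqP].
Qed.

(** * Palette 3-graphs *)

(** The complete graph is one of the factors, and distinct coordinates there force [a], [b], [c] to
    be distinct. *)
Lemma product_edge3 M (a b c : product_vertex M) : 3 < M ->
  (forall O : extendable_graph M, [set a O; b O; c O] \in edges (val O)) ->
  [set a; b; c] \in edges (product_graph M).
Proof.
move=> M4 abc.
have K_ext : extendable (complete_graph 'I_M).
  by rewrite complete_extendable // card_ord.
pose K : extendable_graph M := exist _ (complete_graph _) K_ext.
have [ab ac bc] := edge_neq (abc K).
rewrite inE card_set3; apply/andP; split.
  by apply/and3P; split; [move: ab|move: ac|move: bc]; apply: contra_neq => ->.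
by apply/forallP=> O; rewrite imset_set3.
Qed.

Section Palette.
Variables (V : finType) (rho : V -> nat) (blue : rel V).

Definition palette_triple (t : V * V * V) : bool :=
  let: (u, v, w) := t in
  [&& rho u < rho v, rho v < rho w, ~~ blue u v, ~~ blue u w & blue v w].

Definition set_of_triple (t : V * V * V) : {set V} := [set t.1.1; t.1.2; t.2].

Definition palette_edges : {set {set V}} :=
  [set set_of_triple t | t in palette_triple].

Lemma palette_subproof : [forall e in palette_edges, #|e| == 3].
Proof.
apply/forall_inP=> e /imsetP[[[u v] w] /and5P[uv vw _ _ _] ->].
rewrite card_set3 /=; apply/and3P; split.
- by apply: contraTneq uv => ->; rewrite ltnn.
- by apply: contraTneq (ltn_trans uv vw) => ->; rewrite ltnn.
- by apply: contraTneq vw => ->; rewrite ltnn.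
Qed.

Definition palette_graph : tgraph V := TGraph palette_subproof.

(** The ranks of [u], [v], [w] are distinct, so their set has a single sorted listing. The second
    listing is only weakly sorted because choosing vertices of least rank yields weak
    inequalities. *)
Lemma set_of_triple_sorted_inj (u v w a b c : V) :
  rho u < rho v -> rho v < rho w -> rho a <= rho b -> rho b <= rho c ->
  [set u; v; w] = [set a; b; c] -> (u, v, w) = (a, b, c).
Proof.
move=> uv vw ab bc E.
have : u \in [set a; b; c] by rewrite -E !inE eqxx.
have : v \in [set a; b; c] by rewrite -E !inE eqxx orbT.
have : w \in [set a; b; c] by rewrite -E !inE eqxx !orbT.
rewrite !inE => /orP[/orP[]|] /eqP ww /orP[/orP[]|] /eqP vv /orP[/orP[]|] /eqP uu;
  rewrite ww vv uu in uv vw *; by [|lia].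
Qed.

Lemma palette_edgeP (a b c : V) :
  [set a; b; c] \in edges palette_graph -> rho a <= rho b -> rho b <= rho c ->
  palette_triple (a, b, c).
Proof.
case/imsetP=> [[[u v] w] t /esym E] ab bc; have /and5P[uv vw _ _ _] := t.
by rewrite -(set_of_triple_sorted_inj uv vw ab bc E).
Qed.

(* Take [v] with [rho v] least and then [v'] with [rho v'] least among the
   vertices that differ from [v] in all coordinates.  A common neighbour [x] of
   [v, v'] makes [v' x] blue; a neighbour [u] of [v', x] avoiding [v] in all
   coordinates lies above [v'], which makes [v' x] red. *)
Lemma palette_graph_product_free M : 3 < M -> is_free (product_graph M) palette_graph.
Proof.
move=> M4; apply/negP=> /existsP[f /andP[_ /forall_inP fE]].
have fE3 (a b c : product_vertex M) :
    (forall O : extendable_graph M, [set a O; b O; c O] \in edges (val O)) ->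
    [set f a; f b; f c] \in edges palette_graph.
  by move=> /(product_edge3 M4)/fE; rewrite imset_set3.
have M0 : 0 < M by lia.
have M1 : 1 < M by lia.
pose i0 := Ordinal M0; pose i1 := Ordinal M1.
pose w0 : product_vertex M := [ffun=> i0].
have [v _ vmin] := @arg_minnP _ w0 xpredT (fun w => rho (f w)) isT.
pose avoid : pred (product_vertex M) := fun w => [forall O, w O != v O].
have w1_avoid : avoid [ffun O => if v O == i0 then i1 else i0].
  by apply/forallP=> O; rewrite ffunE;
    case: (eqVneq (v O) i0) => [->|]; rewrite // eq_sym.
have [v' v'v v'min] := @arg_minnP _ _ avoid (fun w => rho (f w)) w1_avoid.
have neigh (a b : product_vertex M) : (forall O, a O != b O) ->
    exists x : product_vertex M,
      forall O : extendable_graph M, [set a O; b O; x O] \in edges (val O).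
  move=> ab.
  have /fin_all_exists[x xE] (O : extendable_graph M) :
      exists u, [set a O; b O; u] \in edges (val O).
    (* Extendability is relative to a vertex to be avoided; any [c] outside the pair serves. *)
    have [c cN] : exists c, c \in ~: [set a O; b O].
      by apply/card_gt0P; rewrite cardsCs setCK card_ord cards2 ab; lia.
    move: cN; rewrite !inE negb_or => /andP[ca cb].
    by have /extendableP/(_ _ _ _ (ab O) ca cb)[u _ uE] := valP O; exists u.
  by exists [ffun O => x O] => O; rewrite ffunE.
have [x xE] : exists x : product_vertex M,
    forall O : extendable_graph M, [set v O; v' O; x O] \in edges (val O).
  by apply: neigh => O; rewrite eq_sym; have /forallP := v'v.
have xv : avoid x.
  by apply/forallP=> O; have [_ vx _] := edge_neq (xE O); rewrite eq_sym.
have /fin_all_exists[u uE] (O : extendable_graph M) :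
    exists u, u != v O /\ [set v' O; x O; u] \in edges (val O).
  have [vv' vx v'x] := edge_neq (xE O).
  by have /extendableP/(_ _ _ _ v'x vv' vx)[u uv uE] := valP O; exists u.
pose u' : product_vertex M := [ffun O => u O].
have u'v : avoid u' by apply/forallP=> O; rewrite ffunE; case: (uE O).
have e1 := fE3 _ _ _ xE.
have e2 : [set f v'; f x; f u'] \in edges palette_graph.
  by apply: fE3 => O; rewrite ffunE; case: (uE O).
have /and5P[_ _ _ _ v'x_blue] := palette_edgeP e1 (vmin _ isT) (v'min _ xv).
case: (leqP (rho (f x)) (rho (f u'))) => xu.
  have /and5P[_ _ /negP + _ _] := palette_edgeP e2 (v'min _ xv) xu.
  by apply.
rewrite setUAC in e2.
have /and5P[_ _ _ /negP + _] := palette_edgeP e2 (v'min _ u'v) (ltnW xu).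
by apply.
Qed.

Lemma card_palette_edges_sub (U : {set V}) :
  #|[set t | palette_triple t & [&& t.1.1 \in U, t.1.2 \in U & t.2 \in U]]|
    <= #|[set e in edges palette_graph | e \subset U]|.
Proof.
rewrite -(card_in_imset (f := set_of_triple)).
  apply/subset_leq_card/subsetP=> e /imsetP[[[u v] w]].
  rewrite inE /= => /andP[t /and3P[uU vU wU]] ->; rewrite inE; apply/andP; split.
    by apply/imsetP; exists (u, v, w).
  by apply/subsetP=> z; rewrite !inE => /orP[/orP[]|] /eqP ->.
move=> [[u v] w] [[a b] c]; rewrite !inE => /andP[/and5P[uv vw _ _ _] _].
move=> /andP[/and5P[ab bc _ _ _] _].
by apply: set_of_triple_sorted_inj => //; apply: ltnW.
Qed.

(** Sorting a 3-subset by rank gives either an increasing triple inside [U] or a tie, and a tied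
    pair can be listed first. The second term is the error due to ties. *)
Lemma binomial3_le_transversal (U : {set V}) :
  'C(#|U|, 3) <=
    #|[set t : V * V * V | (rho t.1.1 < rho t.1.2) && (rho t.1.2 < rho t.2) &
         [&& t.1.1 \in U, t.1.2 \in U & t.2 \in U]]|
    + #|[set t : V * V * V | rho t.1.1 == rho t.1.2]|.
Proof.
set T1 := finset _; set T2 := finset _.
rewrite -cards_draws.
apply: leq_trans (leq_trans
  (leq_card_setU (set_of_triple @: T1) (set_of_triple @: T2)) _);
  last by apply: leq_add; apply: leq_imset_card.
apply/subset_leq_card/subsetP=> e; rewrite inE => /andP[eU /eqP e3].
have [u [v [w [De uv vw]]]] : exists u v w,
    [/\ e = [set u; v; w], rho u <= rho v & rho v <= rho w].
  have [a ae] : exists a, a \in e by apply/card_gt0P; rewrite e3.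
  have [u ue umin] := @arg_minnP _ a (mem e) rho ae.
  have [w we wmax] := @arg_maxnP _ a (mem e) rho ae.
  (* If one vertex attains both the minimum and the maximum, then [rho] is constant on [e] and any
     order will do. *)
  case: (eqVneq u w) => [uw|uw].
    have : #|e :\: [set u]| == 2.
      by rewrite cardsD (setIidPr _) ?sub1set // cards1 e3.
    case/cards2P=> x [y [xy Dxy]].
    have xe : x \in e by have := set21 x y; rewrite -Dxy inE => /andP[].
    have ye : y \in e by have := set22 x y; rewrite -Dxy inE => /andP[].
    exists u, x, y; split; [|exact: umin|].
      by rewrite -(setID e [set u]) (setIidPr _) ?sub1set // Dxy setUA.
    have := wmax x xe; have := umin y ye; rewrite uw; lia.
  have uwe : [set u; w] \subset e by rewrite subUset !sub1set; apply/andP.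
  have : #|e :\: [set u; w]| == 1.
    by rewrite cardsD (setIidPr uwe) cards2 uw e3.
  case/cards1P=> v Dv.
  have ve : v \in e by have := set11 v; rewrite -Dv inE => /andP[].
  exists u, v, w; split; [|exact: umin|exact: wmax].
  by rewrite -(setID e [set u; w]) (setIidPr uwe) Dv setUAC.
have /and3P[uU vU wU] : [&& u \in U, v \in U & w \in U].
  by move/subsetP: eU => sub; apply/and3P; split; apply: sub; rewrite De !inE eqxx ?orbT.
rewrite inE; case: (ltngtP (rho u) (rho v)) uv => // uv _.
  case: (ltngtP (rho v) (rho w)) vw => // vw _.
    by apply/orP; left; apply/imsetP; exists (u, v, w); rewrite // inE /= uv vw uU vU wU.
  apply/orP; right; apply/imsetP; exists (v, w, u); first by rewrite inE /= vw.
  by rewrite De /set_of_triple /= -setUA setUC.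
by apply/orP; right; apply/imsetP; exists (u, v, w); rewrite // inE /= uv.
Qed.

End Palette.

Local Open Scope ring_scope.

(** * A quasirandom colouring *)

Section Lindsey.
Variables (R : realType) (d : nat).
Local Notation Q := ('rV['F_3]_d).

Definition dot (x y : Q) : 'F_3 := \sum_i x 0 i * y 0 i.

Lemma dotDl x y z : dot (x + y) z = dot x z + dot y z.
Proof. by rewrite -big_split; apply: eq_bigr => i _; rewrite !mxE mulrDl. Qed.

Lemma dotZl c x y : dot (c *: x) y = c * dot x y.
Proof. by rewrite /dot mulr_sumr; apply: eq_bigr => i _; rewrite !mxE mulrA. Qed.

Lemma dot_deltal i x : dot (delta_mx 0 i) x = x 0 i.
Proof.
rewrite /dot (bigD1 i) //= big1 ?mxE ?eqxx ?mul1r ?addr0 // => j ji.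
by rewrite mxE eqxx (negPf ji) mul0r.
Qed.

(** The indicator of red minus its frequency 2/3. *)
Definition balanced (c : 'F_3) : R := (c != 0)%:R - 2 / 3.

Lemma balanced_norm c : `|balanced c| <= 1.
Proof. by rewrite /balanced ler_norml; case: (c != 0) => /=; lra. Qed.

Lemma sum_balanced : \sum_c balanced c = 0.
Proof.
rewrite (bigD1 0) //= /balanced eqxx (eq_bigr (fun=> 1 / 3)); last first.
  by move=> c ->; rewrite /=; lra.
rewrite sumr_const (_ : #|_| = 2%N) ?mulr2n /=; first by lra.
by rewrite -[LHS]/(#|[pred c : 'F_3 | c != 0]|) (cardC1 0) card_Fp.
Qed.

Lemma sum_balanced_affine (a b : 'F_3) : b != 0 ->
  \sum_c balanced (a + c * b) = 0.
Proof.
move=> b0; rewrite -[RHS]sum_balanced.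
rewrite [RHS](reindex (fun c => a + c * b)) //.
exists (fun c => (c - a) / b) => c _; first by rewrite addrC addKr mulfK.
by rewrite mulfVK // addrCA subrr addr0.
Qed.

(** If [y' != 0], subtracting from [y] the multiple of [y'] that clears coordinate [j] leaves a
    nonzero coordinate [i]. A combination of the two basis vectors that cancels on [y'] takes
    exactly this value on [y]. *)
Lemma nonproportional_witness (y y' : Q) : (forall c, y != c *: y') ->
  exists2 z, dot z y' = 0 & dot z y != 0.
Proof.
move=> npr.
have nz (v : Q) : v != 0 -> exists i, v 0 i != 0.
  move=> v0; apply/existsP; apply: contra_neqT v0 => /existsPn v0.
  by apply/rowP=> i; rewrite mxE; apply/eqP; have := v0 i; rewrite negbK.
have [-> | /nz[j y'j]] := eqVneq y' 0.
  have /nz[i yi] : y != 0 by have := npr 0; rewrite scale0r.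
  by exists (delta_mx 0 i); rewrite dot_deltal // mxE.
have /nz[i] : y - (y 0 j / y' 0 j) *: y' != 0 by rewrite subr_eq0.
rewrite !mxE => yi.
exists (delta_mx 0 i + (- (y' 0 i / y' 0 j)) *: delta_mx 0 j);
  rewrite dotDl dotZl !dot_deltal.
  by rewrite mulNr mulfVK // subrr.
by apply: contra_neq yi => <-; field.
Qed.

(** Translating [x] along a [z] orthogonal to [y'] but not to [y] preserves the second factor and
    moves [dot x y] through the whole field, over which [balanced] sums to zero. *)
Lemma balanced_correlation0 (y y' : Q) : (forall c, y != c *: y') ->
  \sum_x balanced (dot x y) * balanced (dot x y') = 0.
Proof.
case/nonproportional_witness=> z zy' zy; set S := LHS.
have S_shift c : S = \sum_x balanced (dot x y + c * dot z y) * balanced (dot x y').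
  rewrite /S (reindex_inj (addIr (c *: z))); apply: eq_bigr => x _.
  by rewrite !dotDl !dotZl zy' mulr0 addr0.
have : \sum_(c : 'F_3) S = 0.
  rewrite (eq_bigr _ (fun c _ => S_shift c)) exchange_big big1 //= => x _.
  by rewrite -mulr_suml sum_balanced_affine ?mul0r.
rewrite sumr_const card_Fp // => /eqP.
by rewrite mulrn_eq0 => /eqP.
Qed.

(** Only multiples of [y'] contribute, and there are at most three of them. *)
Lemma balanced_correlation_row (y' : Q) :
  \sum_y `|\sum_x balanced (dot x y) * balanced (dot x y')| <= 3 * #|Q|%:R.
Proof.
pose P := [set c *: y' | c : 'F_3].
rewrite (bigID (mem P)) /= [X in _ + X]big1 ?addr0; last first.
  move=> y yP; rewrite balanced_correlation0 ?normr0 // => c.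
  by apply: contraNneq yP => ->; apply: imset_f.
apply: (@le_trans _ _ (\sum_(y in P) #|Q|%:R)).
  apply: ler_sum => y _; apply: le_trans (ler_norm_sum _ _ _) _.
  apply: (@le_trans _ _ (\sum_(x : Q) 1)); last by rewrite sumr_const.
  by apply: ler_sum => x _; rewrite normrM mulr_ile1 // balanced_norm.
rewrite sumr_const -[leLHS]mulr_natl ler_wpM2r // ler_nat.
by apply: leq_trans (leq_imset_card _ _) _; rewrite card_Fp.
Qed.

(* Lindsey's lemma.  Instead of Cauchy-Schwarz, [a h <= (t a^2 + h^2 / t) / 2]
   is used with [t = eta #|Q|], which avoids square roots. *)
Lemma lindsey (eta : R) (alpha beta : Q -> R) : 0 < eta ->
  3 <= eta ^+ 2 * #|Q|%:R ->
  (forall x, `|alpha x| <= 1) -> (forall y, `|beta y| <= 1) ->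
  `|\sum_x \sum_y balanced (dot x y) * alpha x * beta y| <= eta * #|Q|%:R ^+ 2.
Proof.
move=> eta0 hq ha hb; set q : R := #|Q|%:R in hq *.
have q0 : 0 < q by rewrite ltr0n; apply/card_gt0P; exists 0.
pose h x := \sum_y balanced (dot x y) * beta y.
have h2 : \sum_x h x ^+ 2 <= 3 * q ^+ 2.
  have -> : \sum_x h x ^+ 2 = \sum_y' \sum_y
      beta y * beta y' * \sum_x balanced (dot x y) * balanced (dot x y').
    under [RHS]eq_bigr => y' _ do under eq_bigr => y _ do rewrite mulr_sumr.
    under [RHS]eq_bigr => y' _ do rewrite exchange_big /=.
    rewrite [RHS]exchange_big /=; apply: eq_bigr => x _.
    rewrite expr2 /h mulr_sumr; apply: eq_bigr => y' _.
    rewrite mulr_suml; apply: eq_bigr => y _; ring.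
  apply: (@le_trans _ _ (\sum_(y' : Q) 3 * q)); last first.
    by rewrite sumr_const -[_ *+ _]mulr_natr expr2 mulrA.
  apply: ler_sum => y' _; apply: le_trans (balanced_correlation_row y').
  apply: ler_sum => y _; apply: le_trans (ler_norm _) _.
  rewrite normrM ler_piMl // normrM mulr_ile1 //.
have t0 : 0 < eta * q by rewrite mulr_gt0.
have bound (s : R) : `|s| = 1 ->
    s * (\sum_x \sum_y balanced (dot x y) * alpha x * beta y) <= eta * q ^+ 2.
  move=> s1.
  have -> : \sum_x \sum_y balanced (dot x y) * alpha x * beta y = \sum_x alpha x * h x.
    apply: eq_bigr => x _; rewrite /h mulr_sumr; apply: eq_bigr => y _; ring.
  have s2 : s ^+ 2 = 1 by rewrite -real_normK ?num_real // s1 expr1n.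
  apply: (@le_trans _ _ (\sum_x ((eta * q) / 2 + h x ^+ 2 / (2 * (eta * q))))).
    rewrite mulr_sumr; apply: ler_sum => x _.
    have a2 : alpha x ^+ 2 <= 1 by rewrite -real_normK ?num_real // expr_le1.
    have -> : eta * q / 2 + h x ^+ 2 / (2 * (eta * q)) =
       ((eta * q) ^+ 2 + h x ^+ 2) / (2 * (eta * q)) by field; rewrite !gt_eqF.
    rewrite ler_pdivlMr ?mulr_gt0 //.
    have := sqr_ge0 (eta * q * (s * alpha x) - h x).
    have : (eta * q) ^+ 2 * (s ^+ 2 * alpha x ^+ 2) <= (eta * q) ^+ 2.
      by rewrite s2 mul1r ler_piMr // sqr_ge0.
    nra.
  rewrite big_split /= sumr_const -mulr_suml -[_ *+ _]mulr_natr -/q.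
  (* By [hq], the second moment [3 * q ^+ 2] is at most [eta ^+ 2 * q ^+ 3], so both halves of the
     bound are equal to [eta * q ^+ 2 / 2]. *)
  have H : (\sum_x h x ^+ 2) / (2 * (eta * q)) <= eta * q ^+ 2 / 2.
    rewrite ler_pdivrMr ?mulr_gt0 //; apply: le_trans h2 _.
    have := ler_wpM2r (ltW (exprn_gt0 2 q0)) hq; nra.
  have -> : eta * q ^+ 2 = eta * q / 2 * q + eta * q ^+ 2 / 2 by field.
  by rewrite lerD2l.
rewrite ler_norml; apply/andP; split.
  by have := bound (-1); rewrite normrN normr1 mulN1r => /(_ erefl); rewrite lerNl.
by have := bound 1; rewrite normr1 mul1r => /(_ erefl).
Qed.

End Lindsey.

(** * The block palette and its uniform density *)

Lemma sum_pair (R : nmodType) (I J : finType) (F : I * J -> R) :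
  \sum_p F p = \sum_i \sum_j F (i, j).
Proof. by rewrite pair_bigA; apply: eq_bigr => -[]. Qed.

Section BlockPalette.
Variables (R : realType) (m d : nat).
Local Notation Q := ('rV['F_3]_d).
Local Notation V := ('I_m * Q)%type.

Definition block (u : V) : nat := u.1.

Definition orthogonal_rel : rel V := fun u v => dot u.2 v.2 == 0.

Definition block_palette : tgraph V := palette_graph block orthogonal_rel.

Local Notation lt u v := ((block u < block v)%N%:R : R).
Local Notation G u v := (balanced R (dot u.2 v.2)).
Local Notation q := (#|Q|%:R : R).
Local Notation n := (#|{: V}|%:R : R).

Lemma card_blocks : n = m%:R * q.
Proof. by rewrite card_prod card_ord natrM. Qed.

(** The order is constant on each pair of blocks, so Lindsey's lemma applies to every pair of blocks
    separately. *)
Lemma block_lindsey (eta : R) (alpha beta : V -> R) : 0 < eta ->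
  3 <= eta ^+ 2 * q ->
  (forall u, `|alpha u| <= 1) -> (forall v, `|beta v| <= 1) ->
  `|\sum_u \sum_v lt u v * G u v * alpha u * beta v| <= eta * n ^+ 2.
Proof.
move=> eta0 hq ha hb.
have -> : \sum_u \sum_v lt u v * G u v * alpha u * beta v =
    \sum_(s < m) \sum_(t < m) (s < t)%N%:R *
      \sum_(x : Q) \sum_(y : Q) balanced R (dot x y) * alpha (s, x) * beta (t, y).
  rewrite sum_pair; apply: eq_bigr => s _.
  under [RHS]eq_bigr => t _ do rewrite mulr_sumr.
  rewrite [RHS]exchange_big /=; apply: eq_bigr => x _.
  rewrite sum_pair; apply: eq_bigr => t _; rewrite mulr_sumr; apply: eq_bigr => y _.
  by rewrite /block /= !mulrA.
apply: (@le_trans _ _ (\sum_(s < m) \sum_(t < m) eta * q ^+ 2)).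
  apply: le_trans (ler_norm_sum _ _ _) _; apply: ler_sum => s _.
  apply: le_trans (ler_norm_sum _ _ _) _; apply: ler_sum => t _.
  have L := lindsey eta0 hq (fun x => ha (s, x)) (fun y => hb (t, y)).
  rewrite normrM; apply: le_trans L; rewrite ler_piMl //.
  by case: (_ < _)%N; rewrite ?normr1 ?normr0.
rewrite !sumr_const !card_ord card_blocks -[_ *+ _ *+ _]mulr_natr -[_ *+ _]mulr_natr.
by rewrite le_eqVlt; apply/orP; left; apply/eqP; ring.
Qed.

Section Density.
Variables (eta : R) (U : {set V}).
Hypotheses (eta0 : 0 < eta) (hq : 3 <= eta ^+ 2 * q).

Local Notation i u := ((u \in U)%:R : R).
Local Notation chi u v w := (lt u v * lt v w * i u * i v * i w).
(** Red and blue indicators as mean plus deviation. In a product of two red factors and a blue one,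
    the factors are replaced by their means one at a time; this leaves the main term
    [2/3 * 2/3 * 1/3 = 4/27] and three discrepancies, each with one factor [G]. *)
Local Notation r u v := (2 / 3 + G u v).
Local Notation b u v := (1 / 3 - G u v).

Lemma natb_norm (c : bool) : `|c%:R : R| <= 1.
Proof. by case: c; rewrite ?normr1 ?normr0. Qed.

Lemma norm_mul_le1 (x y : R) : `|x| <= 1 -> `|y| <= 1 -> `|x * y| <= 1.
Proof. by move=> x1 y1; rewrite normrM mulr_ile1. Qed.

Lemma red_indicator u v : r u v = (~~ orthogonal_rel u v)%:R.
Proof. by rewrite /balanced /orthogonal_rel; lra. Qed.

Lemma blue_indicator u v : b u v = (orthogonal_rel u v)%:R.
Proof. by rewrite /balanced /orthogonal_rel; case: eqP => _ /=; lra. Qed.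

Lemma sum_norm_le (F : V -> R) B :
  (forall u, `|F u| <= B) -> `|\sum_u F u| <= n * B.
Proof.
move=> FB; apply: le_trans (ler_norm_sum _ _ _) _.
by apply: le_trans (ler_sum _ (fun u _ => FB u)) _; rewrite sumr_const mulr_natl.
Qed.

(** For fixed [w], the remaining factors split into a function of [u] and a function of [v]. *)
Lemma discrepancy_uv :
  `|\sum_u \sum_v \sum_w chi u v w * (G u v * r u w * b v w)| <= eta * n ^+ 3.
Proof.
under eq_bigr => u _ do rewrite exchange_big /=.
rewrite exchange_big /= [n ^+ 3]exprS mulrCA; apply: sum_norm_le => w.
have -> : \sum_u \sum_v chi u v w * (G u v * r u w * b v w) =
    \sum_u \sum_v lt u v * G u v * (i u * r u w * i w) * (i v * lt v w * b v w).
  by do 2!apply: eq_bigr => ? _; ring.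
apply: block_lindsey => // u; rewrite ?red_indicator ?blue_indicator;
  by rewrite !norm_mul_le1 ?natb_norm.
Qed.

Lemma discrepancy_uw :
  `|\sum_u \sum_v \sum_w chi u v w * (G u w * b v w)| <= eta * n ^+ 3.
Proof.
rewrite exchange_big /= [n ^+ 3]exprS mulrCA; apply: sum_norm_le => v.
(* The order factor [lt u w] that [block_lindsey] expects can be inserted by transitivity through
   [v]. *)
have -> : \sum_u \sum_w chi u v w * (G u w * b v w) =
    \sum_u \sum_w lt u w * G u w * (i u * lt u v) * (i v * i w * lt v w * b v w).
  do 2!apply: eq_bigr => ? _.
  case: ltnP => [uv|_]; last by rewrite !(mul0r, mulr0).
  case: ltnP => [vw|_]; last by rewrite !(mul0r, mulr0).
  by rewrite (ltn_trans uv vw) /=; ring.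
apply: block_lindsey => // u; rewrite ?blue_indicator;
  by rewrite !norm_mul_le1 ?natb_norm.
Qed.

Lemma discrepancy_vw :
  `|\sum_u \sum_v \sum_w chi u v w * G v w| <= eta * n ^+ 3.
Proof.
rewrite [n ^+ 3]exprS mulrCA; apply: sum_norm_le => u.
have -> : \sum_v \sum_w chi u v w * G v w =
    \sum_v \sum_w lt v w * G v w * (i u * i v * lt u v) * i w.
  by do 2!apply: eq_bigr => ? _; ring.
by apply: block_lindsey => // v; rewrite ?norm_mul_le1 ?natb_norm.
Qed.

Lemma card_triples (P : pred (V * V * V)) :
  #|[set t | P t]|%:R = \sum_u \sum_v \sum_w ((P (u, v, w))%:R : R).
Proof.
rewrite -sum1_card natr_sum big_mkcond /= [LHS]sum_pair [LHS]sum_pair.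
by do 3!apply: eq_bigr => ? _; rewrite inE; case: (P _).
Qed.

Lemma palette_triples_ge :
  4 / 27 * #|[set t : V * V * V |
                (block t.1.1 < block t.1.2)%N && (block t.1.2 < block t.2)%N &
                [&& t.1.1 \in U, t.1.2 \in U & t.2 \in U]]|%:R - 3 * (eta * n ^+ 3) <=
  #|[set t | palette_triple block orthogonal_rel t &
                [&& t.1.1 \in U, t.1.2 \in U & t.2 \in U]]|%:R.
Proof.
rewrite !card_triples /=.
have -> : \sum_u \sum_v \sum_w
      ((palette_triple block orthogonal_rel (u, v, w) &&
        [&& u \in U, v \in U & w \in U])%:R : R) =
    4 / 27 * (\sum_u \sum_v \sum_w
      ((block u < block v)%N && (block v < block w)%N &&
        [&& u \in U, v \in U & w \in U])%:R)
    + \sum_u \sum_v \sum_w chi u v w * (G u v * r u w * b v w)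
    + 2 / 3 * (\sum_u \sum_v \sum_w chi u v w * (G u w * b v w))
    - 4 / 9 * (\sum_u \sum_v \sum_w chi u v w * G v w).
  rewrite !mulr_sumr -!sumrN -!big_split /=; apply: eq_bigr => u _.
  rewrite !mulr_sumr -!sumrN -!big_split /=; apply: eq_bigr => v _.
  rewrite !mulr_sumr -!sumrN -!big_split /=; apply: eq_bigr => w _.
  transitivity (chi u v w * (r u v * r u w * b v w)).
    rewrite !red_indicator !blue_indicator -!natrM !mulnb.
    by congr (_%:R); congr nat_of_bool; rewrite -!andbA; do !bool_congr.
  rewrite (_ : ((_ && _)%:R : R) = chi u v w); first by field.
  by rewrite -!natrM !mulnb -!andbA.
have /ler_normlP[uv _] := discrepancy_uv.
have /ler_normlP[uw _] := discrepancy_uw.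
have /ler_normlP[_ vw] := discrepancy_vw.
(* The discrepancies carry the weights 1, 2/3 and 4/9, whose sum is rounded up to 3. *)
have : 0 <= eta * n ^+ 3 by rewrite mulr_ge0 ?exprn_ge0 // ltW.
by lra.
Qed.

End Density.

(** Tied triples make up at most a fraction [1 / m] of all triples. *)
Lemma card_same_block :
  (#|[set t : V * V * V | block t.1.1 == block t.1.2]| <= m ^ 2 * #|Q| ^ 3)%N.
Proof.
pose f (t : 'I_m * Q * Q * V) : V * V * V :=
  let: (s, x, y, w) := t in ((s, x), (s, y), w).
apply: (@leq_trans #|[set f t | t in [set: 'I_m * Q * Q * V]]|).
  apply/subset_leq_card/subsetP=> -[[[s x] [t y]] w]; rewrite inE => /eqP /= st.
  have -> : t = s by apply: val_inj.
  by apply/imsetP; exists (s, x, y, w); rewrite ?inE.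
apply: leq_trans (leq_imset_card _ _) _.
by rewrite cardsT !card_prod card_ord; apply: eq_leq; ring.
Qed.

Lemma block_palette_uniformly_dense (eta : R) : 0 < eta ->
  3 <= (eta / 6) ^+ 2 * q -> 2 <= eta * m%:R ->
  uniformly_dense (4 / 27) eta block_palette.
Proof.
move=> eta0 hq hm U.
(* With [eta / 6] the three discrepancies cost [eta / 2]; [hm] keeps the tied triples within the
   other half. *)
have eta60 : 0 < eta / 6 by lra.
have H1 := palette_triples_ge U eta60 hq.
have := card_palette_edges_sub block orthogonal_rel U.
rewrite -(ler_nat R) => H2.
have := binomial3_le_transversal block U.
rewrite -(ler_nat R) natrD => H3.
have := card_same_block; rewrite -(ler_nat R) natrM !natrX => H4.
apply: le_trans (le_trans H1 H2).
have H5 : 2 * (m%:R ^+ 2 * q ^+ 3) <= eta * n ^+ 3.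
  rewrite card_blocks; have m0 : 0 <= m%:R ^+ 2 * q ^+ 3 by rewrite mulr_ge0 ?exprn_ge0.
  by have := ler_wpM2r m0 hm; congr (_ <= _); ring.
have := ler0n R #|[set t : V * V * V | block t.1.1 == block t.1.2]|.
lra.
Qed.

End BlockPalette.

(** * The two Turán densities of the product *)

Lemma product_graph_uniform_density (R : realType) M : (3 < M)%N ->
  4 / 27 <= uniform_turan_density R (product_graph M).
Proof.
move=> M4; apply: ub_le_sup; first by exists 1 => x [/andP[]].
split; first by apply/andP; split; lra.
move=> eta n0 eta0.
have [m hm] : exists m : nat, 2 <= eta * m%:R.
  exists (Num.bound (2 / eta)); rewrite mulrC -ler_pdivrMr //.
  by apply: ltW; apply: archi_boundP; rewrite divr_ge0 // ltW.
pose K := Num.bound (3 / (eta / 6) ^+ 2).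
have eta60 : 0 < (eta / 6) ^+ 2 by rewrite exprn_gt0 // divr_gt0.
(* One dimension serves both lower bounds, since [3 ^ d > d]. *)
pose d := maxn n0 K.
have cQ : (d < #|{: 'rV['F_3]_d}|)%N by rewrite card_mx card_Fp // mul1n ltn_expl.
exists ('I_m * 'rV['F_3]_d)%type, (block_palette m d); split.
- have m0 : (0 < m)%N by case: m hm => //; rewrite mulr0; lra.
  rewrite card_prod card_ord; apply: leq_trans (leq_pmull _ m0).
  by apply: leq_trans (ltnW cQ); rewrite leq_maxl.
- exact: palette_graph_product_free.
apply: block_palette_uniformly_dense => //.
rewrite mulrC -ler_pdivrMr //; apply: le_trans (_ : K%:R <= _).
  by apply: ltW; apply: archi_boundP; rewrite divr_ge0 // ltW.
by rewrite ler_nat; apply: leq_trans (ltnW cQ); rewrite leq_maxr.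
Qed.

Lemma codegree_density_le (R : realType) (W : finType) (F : tgraph W) (eps : R) n0 :
  0 <= eps ->
  (forall n, (n0 <= n)%N -> forall H : tgraph 'I_n, is_free F H ->
     (min_codegree H)%:R <= eps * n%:R) ->
  codegree_turan_density R F <= eps.
Proof.
move=> eps0 small; rewrite /codegree_turan_density.
set u := fun n : nat => _.
(* [lim] takes the value 0 on a divergent filter. *)
have [cv|/dvgP ->] := pselect (cvg (u @ \oo)%classic); last exact: eps0.
apply: limr_le => //; exists (n0 + 1)%N => // n /= nn0.
have [{}nn0 n1] : (n0 <= n)%N /\ (0 < n)%N by move: nn0; rewrite /=; lia.
rewrite /u ler_pdivrMr ?ltr0n //.
(* The value 0 of an empty maximum is covered by [0 <= eps]. *)
rewrite /ex_co; elim/big_ind: _ => [|x y hx hy|H HF]; last exact: small.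
  by rewrite mulr_ge0.
by rewrite /maxn; case: ifP.
Qed.

Theorem theorem1p4 (R : realType) (eps : R) (heps : 0 < eps) :
  exists (W : finType) (F : tgraph W),
    4%:R / 27%:R <= uniform_turan_density R F
    /\ codegree_turan_density R F <= eps.
Proof.
(* Then [p.+1 * eps >= 1], so a codegree above [eps * n] is at least [n / p.+1]. *)
pose p := Num.bound eps^-1.
have [M M4 [n0 force]] := codegree_forces_product p.
exists (product_vertex M), (product_graph M); split.
  exact: product_graph_uniform_density.
apply: (@codegree_density_le _ _ _ _ n0) => [|n nn0 H]; first exact: ltW.
apply: contraNT; rewrite -ltNge => Hbig; apply: force; first by rewrite card_ord.
rewrite card_ord -(ler_nat R) natrM.
have peps : 1 <= p.+1%:R * eps.
  rewrite -ler_pdivrMr // div1r; apply: ltW; apply: lt_le_trans (archi_boundP _) _.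
    by rewrite invr_ge0 ltW.
  by rewrite ler_nat.
have p0 : (0 : R) <= p.+1%:R by [].
apply: le_trans (ler_wpM2l p0 (ltW Hbig)).
by rewrite mulrA ler_peMl.
Qed.
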